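(* Let $R$ be an Artinian local ring and let $I$ be an ideal of $R$ of finite $G$-dimension, generated by $x_1,\ldots,x_n$. Suppose that $\mathrm{Ann}_R(H_i(I;R))\subseteq\mathrm{Ann}_R(H_{i+1}(I;R))$ for all $0\le i\le n-1$. Then $\mathrm{Ann}_R(H_i(I;R))=I$ for all $1\le i\le n$.
   Context: $H_i(I;R)=H_i(K(I;R))$ denotes the $i$-th homology of the Koszul complex on the generators $x_1,\ldots,x_n$ of $I$ with coefficients in $R$. $G$-dimension is the Gorenstein dimension of Auslander–Bridger. *)

(* Defs.v *)
From HB Require Import structures.
From mathcomp Require Import all_boot all_order all_algebra.
From mathcomp Require Import boolp ring.

Set Implicit Arguments.
Unset Strict Implicit.
Unset Printing Implicit Defensive.

Import GRing.Theory.
Local Open Scope ring_scope.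

Record submod (R : comNzRingType) (V : lmodType R) (S : submodClosed V) :=
  Submod { submod_val : V; _ : submod_val \in S }.

Section Submod.
Context (R : comNzRingType) (V : lmodType R) (S : submodClosed V).
HB.instance Definition _ := [isSub for @submod_val R V S].
HB.instance Definition _ := [Choice of submod S by <:].
HB.instance Definition _ := [SubChoice_isSubLmodule of submod S by <:].
End Submod.

Section Quotmod.
Context (R : comNzRingType) (V : lmodType R) (S : submodClosed V).
Local Open Scope quotient_scope.

Definition submod_zmodClosed : zmodClosed V :=
  HB.pack_for (zmodClosed V) (GRing.SubmodClosed.sort S)
    (GRing.isZmodClosed.Build V (GRing.SubmodClosed.sort S)
      (GRing.submod_closedB (submodClosedP S))).
Local Notation S_zmod := submod_zmodClosed.

Definition quotmod := Quotient.quot S_zmod.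
HB.instance Definition _ := GRing.Zmodule.on quotmod.

Definition quotmod_pi (v : V) : quotmod := \pi_(Quotient.quot S_zmod) v.
Definition quotmod_repr (u : quotmod) : V := repr (u : Quotient.quot S_zmod).
Definition quotmod_scale (a : R) (u : quotmod) : quotmod :=
  quotmod_pi (a *: quotmod_repr u).

Lemma quotmod_reprK : cancel quotmod_repr quotmod_pi.
Proof. by move=> u; rewrite /quotmod_pi /quotmod_repr reprK. Qed.

Lemma quotmod_piE u v : (quotmod_pi u == quotmod_pi v) = (u - v \in S).
Proof. by rewrite -(Quotient.idealrBE S_zmod). Qed.

Lemma quotmod_piD u v : quotmod_pi (u + v) = quotmod_pi u + quotmod_pi v.
Proof. exact: (raddfD \pi_(Quotient.quot S_zmod)). Qed.

Lemma quotmod_piZ a v : quotmod_pi (a *: v) = quotmod_scale a (quotmod_pi v).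
Proof.
apply/eqP; rewrite quotmod_piE -scalerBr rpredZ // -quotmod_piE.
by rewrite quotmod_reprK.
Qed.

Lemma quotmod_scaleA a b u :
  quotmod_scale a (quotmod_scale b u) = quotmod_scale (a * b) u.
Proof. by rewrite -[u]quotmod_reprK -!quotmod_piZ scalerA. Qed.

Lemma quotmod_scale1 : left_id 1 quotmod_scale.
Proof. by move=> u; rewrite -[u]quotmod_reprK -!quotmod_piZ scale1r. Qed.

Lemma quotmod_scaleDr : right_distributive quotmod_scale +%R.
Proof.
move=> a u v; rewrite -[u]quotmod_reprK -[v]quotmod_reprK.
by rewrite -quotmod_piD -!quotmod_piZ -quotmod_piD scalerDr.
Qed.

Lemma quotmod_scaleDl u : {morph quotmod_scale^~ u : a b / a + b}.
Proof.
move=> a b; rewrite -[u]quotmod_reprK -!quotmod_piZ -quotmod_piD.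
by rewrite scalerDl.
Qed.

HB.instance Definition _ := GRing.Zmodule_isLmodule.Build R quotmod
  quotmod_scaleA quotmod_scale1 quotmod_scaleDr quotmod_scaleDl.

Lemma quotmod_pi_is_linear : linear quotmod_pi.
Proof. by move=> a u v; rewrite quotmod_piD quotmod_piZ. Qed.
HB.instance Definition _ :=
  GRing.isLinear.Build R V quotmod _ quotmod_pi quotmod_pi_is_linear.
End Quotmod.

Section Subquot.
Context (R : comNzRingType) (V : lmodType R) (Z B : submodClosed V).

Definition restr_pred : {pred submod Z} := [pred u | val u \in B].

Lemma restr_pred_submod_closed : submod_closed restr_pred.
Proof.
split=> [|a u v]; rewrite !inE; first by rewrite raddf0 rpred0.
by move=> uB vB; rewrite linearP rpredD // rpredZ.
Qed.
HB.instance Definition _ := GRing.isSubmodClosed.Build R (submod Z)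
  restr_pred (GRing.submod_closed_semi restr_pred_submod_closed).

(* This is Z / (Z \cap B), that is Z / B as soon as B is contained in Z. *)
Definition subquot := quotmod restr_pred.
HB.instance Definition _ := GRing.Lmodule.on subquot.
End Subquot.

Definition Hom (R : comNzRingType) (U V : lmodType R) := {linear U -> V}.

Section Hom.
Context (R : comNzRingType) (U V : lmodType R).
Implicit Types f g h : Hom U V.

HB.instance Definition _ := gen_eqMixin (Hom U V).
HB.instance Definition _ := gen_choiceMixin (Hom U V).

Lemma Hom_ext f g : f =1 g -> f = g.
Proof.
case: f g => f [[Pf] [Qf]] [g [[Pg] [Qg]]] /= /funext fg.
move: Pf Qf; rewrite fg => Pf Qf.
by rewrite (Prop_irrelevance Pf Pg) (Prop_irrelevance Qf Qg).
Qed.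

Definition Hom_zero : Hom U V := \0.
Definition Hom_opp f : Hom U V := \- f.
Definition Hom_add f g : Hom U V := f \+ g.
Definition Hom_scale (a : R) f : Hom U V := a \*: f.

Lemma Hom_addA : associative Hom_add.
Proof. by move=> f g h; apply: Hom_ext => u /=; rewrite addrA. Qed.
Lemma Hom_addC : commutative Hom_add.
Proof. by move=> f g; apply: Hom_ext => u /=; rewrite addrC. Qed.
Lemma Hom_add0 : left_id Hom_zero Hom_add.
Proof. by move=> f; apply: Hom_ext => u /=; rewrite add0r. Qed.
Lemma Hom_addN : left_inverse Hom_zero Hom_opp Hom_add.
Proof. by move=> f; apply: Hom_ext => u /=; rewrite addNr. Qed.
HB.instance Definition _ := GRing.isZmodule.Build (Hom U V)
  Hom_addA Hom_addC Hom_add0 Hom_addN.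

Lemma Hom_scaleA a b f : Hom_scale a (Hom_scale b f) = Hom_scale (a * b) f.
Proof. by apply: Hom_ext => u /=; rewrite scalerA. Qed.
Lemma Hom_scale1 : left_id 1 Hom_scale.
Proof. by move=> f; apply: Hom_ext => u /=; rewrite scale1r. Qed.
Lemma Hom_scaleDr : right_distributive Hom_scale +%R.
Proof. by move=> a f g; apply: Hom_ext => u /=; rewrite scalerDr. Qed.
Lemma Hom_scaleDl f : {morph Hom_scale^~ f : a b / a + b}.
Proof. by move=> a b; apply: Hom_ext => u /=; rewrite scalerDl. Qed.
HB.instance Definition _ := GRing.Zmodule_isLmodule.Build R (Hom U V)
  Hom_scaleA Hom_scale1 Hom_scaleDr Hom_scaleDl.
End Hom.

Definition dual (R : comNzRingType) (M : lmodType R) : lmodType R := Hom M R^o.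

Section Biduality.
Context (R : comNzRingType) (M : lmodType R).

Definition dual_eval (m : M) (phi : dual M) : R^o := (phi : Hom M R^o) m.

Lemma dual_eval_is_linear m : linear (dual_eval m).
Proof. by []. Qed.
HB.instance Definition _ m := GRing.isLinear.Build R (dual M) R^o _
  (dual_eval m) (dual_eval_is_linear m).

Definition biduality (m : M) : dual (dual M) := dual_eval m : Hom (dual M) R^o.

Lemma biduality_is_linear : linear biduality.
Proof. by move=> a u v; apply: Hom_ext => phi; apply: linearP. Qed.
HB.instance Definition _ := GRing.isLinear.Build R M (dual (dual M)) _
  biduality biduality_is_linear.
End Biduality.

(* ... -> P_2 -> P_1 -> P_0 -> M -> 0 exact *)
Record resolution (R : comNzRingType) (M : lmodType R) := Resolution {
  res_mod :> nat -> lmodType R;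
  res_diff : forall i, {linear res_mod i.+1 -> res_mod i};
  res_aug : {linear res_mod 0%N -> M};
  res_aug_surj : forall m, exists u, res_aug u = m;
  res_exact0 : forall u, res_aug u = 0 <-> exists v, res_diff 0%N v = u;
  res_exactS : forall i u,
    res_diff i u = 0 <-> exists v, res_diff i.+1 v = u }.

Definition projective (R : comNzRingType) (P : lmodType R) :=
  forall (A B : lmodType R) (g : {linear A -> B}) (f : {linear P -> B}),
    (forall b, exists a, g a = b) ->
    exists h : {linear P -> A}, forall p, g (h p) = f p.

Section Ext.
Context (R : comNzRingType) (M : lmodType R) (P : resolution M).
Context (N : lmodType R).

Definition ext_cocycle i : {pred Hom (P i) N} :=
  [pred phi : Hom (P i) N | `[< forall u, phi (res_diff P i u) = 0 >]].
Arguments ext_cocycle : clear implicits.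

Lemma ext_cocycle_submod_closed i : submod_closed (ext_cocycle i).
Proof.
split=> [|a phi psi]; rewrite !inE; first exact/asboolP.
move=> /asboolP phi0 /asboolP psi0; apply/asboolP => u /=.
by rewrite phi0 psi0 scaler0 addr0.
Qed.
HB.instance Definition _ i := GRing.isSubmodClosed.Build R (Hom (P i) N)
  (ext_cocycle i) (GRing.submod_closed_semi (ext_cocycle_submod_closed i)).

Definition ext_coboundary i : {pred Hom (P i) N} :=
  match i with
  | 0%N => [pred phi : Hom (P 0%N) N | phi == 0]
  | j.+1 => [pred phi : Hom (P j.+1) N |
      `[< exists psi : Hom (P j) N, forall u, phi u = psi (res_diff P j u) >]]
  end.
Arguments ext_coboundary : clear implicits.

Lemma ext_coboundary_submod_closed i : submod_closed (ext_coboundary i).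
Proof.
case: i => [|i]; split=> [|a phi psi]; rewrite !inE //.
- by move=> /eqP-> /eqP->; rewrite scaler0 addr0.
- by apply/asboolP; exists 0.
move=> /asboolP[phi' phiE] /asboolP[psi' psiE]; apply/asboolP.
by exists (a *: phi' + psi') => u /=; rewrite phiE psiE.
Qed.
HB.instance Definition _ i := GRing.isSubmodClosed.Build R (Hom (P i) N)
  (ext_coboundary i) (GRing.submod_closed_semi (ext_coboundary_submod_closed i)).

(* The i-th cohomology module of the complex Hom(P, N) *)
Definition Ext (i : nat) : lmodType R :=
  subquot (ext_cocycle i) (ext_coboundary i).
End Ext.

Definition trivial_mod (R : comNzRingType) (M : lmodType R) :=
  forall m : M, m = 0.

(* Ext^i(M, N) = 0; by the comparison theorem, the choice of the projective
   resolution is immaterial. *)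
Definition Ext_vanishes (R : comNzRingType) (M N : lmodType R) (i : nat) :=
  exists P : resolution M,
    (forall j, projective (P j)) /\ trivial_mod (Ext P N i).

Definition finitely_generated (R : comNzRingType) (M : lmodType R) :=
  exists k (g : 'I_k -> M), forall m, exists a : 'I_k -> R,
    m = \sum_i a i *: g i.

(* The modules of G-dimension 0 of Auslander and Bridger *)
Definition totally_reflexive (R : comNzRingType) (M : lmodType R) :=
  [/\ finitely_generated M,
      bijective (@biduality R M),
      forall i, (0 < i)%N -> Ext_vanishes M R^o i &
      forall i, (0 < i)%N -> Ext_vanishes (dual M) R^o i].

(* There is an exact sequence 0 -> G_k -> ... -> G_0 -> M -> 0 with every G_i
   of G-dimension 0; the null module has G-dimension 0, which allows encoding
   the finite sequence as a resolution that vanishes beyond degree k. *)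
Definition Gdim_le (R : comNzRingType) (M : lmodType R) (k : nat) :=
  exists G : resolution M,
    (forall i, totally_reflexive (G i)) /\
    (forall i, (k < i)%N -> trivial_mod (G i)).

Definition finite_Gdim (R : comNzRingType) (M : lmodType R) :=
  exists k, Gdim_le M k.

Definition ideal (R : comNzRingType) := submodClosed R^o.

Definition artinian (R : comNzRingType) :=
  forall J : nat -> ideal R, (forall k, {subset J k.+1 <= J k}) ->
    exists k0, forall k, (k0 <= k)%N -> J k =i J k0.

Definition maximal_ideal (R : comNzRingType) (J : ideal R) :=
  (1 : R^o) \notin J /\
  forall J' : ideal R, {subset J <= J'} -> (1 : R^o) \notin J' -> J' =i J.

Definition local_ring (R : comNzRingType) :=
  exists m : ideal R, maximal_ideal m /\
    forall m' : ideal R, maximal_ideal m' -> m' =i m.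

Definition generated_by (R : comNzRingType) (n : nat) (x : 'I_n -> R)
    (I : ideal R) :=
  forall r : R^o, r \in I <-> exists a : 'I_n -> R, r = \sum_i a i * x i.

Definition annihilator (R : comNzRingType) (M : lmodType R) : {pred R^o} :=
  [pred r : R^o | `[< forall m : M, (r : R) *: m = 0 >]].

(* The exterior algebra of R^n, a form c standing for the sum over the subsets
   S of 'I_n of c S * e_S, where e_S = e_(i_1) /\ ... /\ e_(i_p) with
   S = {i_1 < ... < i_p}. *)
Definition koszul (R : comNzRingType) (n : nat) : lmodType R :=
  {ffun {set 'I_n} -> R^o}.

Section Koszul.
Context (R : comNzRingType) (n : nat) (x : 'I_n -> R).
Implicit Types c : koszul R n.

(* d e_S = \sum_k (-1)^(k-1) x_(i_k) e_(S \ i_k), written on coordinates: e_T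
   occurs in d e_S when S is obtained by adding some j to T, and then k - 1 is
   the number of elements of T that are smaller than j. *)
Definition koszul_diff c : koszul R n :=
  [ffun T : {set 'I_n} => \sum_(j < n | j \notin T)
     (-1) ^+ #|[set k in T | (k < j)%N]| * x j * c (j |: T)].

Lemma koszul_diff_is_linear : linear koszul_diff.
Proof.
move=> a u v; apply/ffunP => T; rewrite !ffunE scaler_sumr -big_split /=.
apply: eq_bigr => j _; rewrite !ffunE mulrDr; congr (_ + _).
exact: scalerAr.
Qed.
HB.instance Definition _ := GRing.isLinear.Build R (koszul R n) (koszul R n) _
  koszul_diff koszul_diff_is_linear.

Definition koszul_deg (p : nat) : {pred koszul R n} :=
  [pred c : koszul R n | [forall S : {set 'I_n}, (c S != 0) ==> (#|S| == p)]].

Definition koszul_cycle (p : nat) : {pred koszul R n} :=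
  [pred c : koszul R n | (c \in koszul_deg p) && (koszul_diff c == 0)].

Definition koszul_boundary (p : nat) : {pred koszul R n} :=
  [pred c : koszul R n |
    `[< exists2 b, b \in koszul_deg p.+1 & c = koszul_diff b >]].

Lemma koszul_degP p c :
  reflect (forall S : {set 'I_n}, #|S| != p -> c S = 0) (c \in koszul_deg p).
Proof.
apply: (iffP forallP) => cp S; last by apply/implyP; apply: contraNT => /cp->.
by apply: contraNeq => cS; apply: (implyP (cp S)).
Qed.

Lemma koszul_deg_submod_closed p : submod_closed (koszul_deg p).
Proof.
split=> [|a u v]; first by apply/koszul_degP => S _; rewrite ffunE.
move=> /koszul_degP up /koszul_degP vp; apply/koszul_degP => S Sp.
by rewrite !ffunE up // vp // scaler0 addr0.
Qed.

Lemma koszul_cycle_submod_closed p : submod_closed (koszul_cycle p).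
Proof.
have [d0 dD] := koszul_deg_submod_closed p.
split=> [|a u v].
  by apply/andP; split; [apply: d0 | rewrite linear0].
move=> /andP[up /eqP u0] /andP[vp /eqP v0]; apply/andP; split; first exact: dD.
by apply/eqP; rewrite linearP/= u0 v0 scaler0 addr0.
Qed.
HB.instance Definition _ p := GRing.isSubmodClosed.Build R (koszul R n)
  (koszul_cycle p) (GRing.submod_closed_semi (koszul_cycle_submod_closed p)).

Lemma koszul_boundary_submod_closed p : submod_closed (koszul_boundary p).
Proof.
have [d0 dD] := koszul_deg_submod_closed p.+1.
split=> [|a u v]; rewrite !inE.
  by apply/asboolP; exists 0; rewrite ?linear0.
move=> /asboolP[u' u'p ->] /asboolP[v' v'p ->]; apply/asboolP.
by exists (a *: u' + v'); [apply: dD | rewrite linearP].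
Qed.
HB.instance Definition _ p := GRing.isSubmodClosed.Build R (koszul R n)
  (koszul_boundary p) (GRing.submod_closed_semi (koszul_boundary_submod_closed p)).

Definition koszul_homology (p : nat) : lmodType R :=
  subquot (koszul_cycle p) (koszul_boundary p).
End Koszul.

Lemma sum_alt (R : comNzRingType) n (g : 'I_n -> 'I_n -> R) :
  (forall j, g j j = 0) -> (forall j k, g k j = - g j k) ->
  \sum_j \sum_k g j k = 0.
Proof.
move=> g0 gN.
have E j : \sum_k g j k =
    \sum_(k < n | (j < k)%N) g j k + \sum_(k < n | (k < j)%N) g j k.
  rewrite (bigID (fun k : 'I_n => (j < k)%N)) /=; congr (_ + _).
  rewrite (bigD1 j) ?ltnn //= g0 add0r; apply: eq_bigl => k.
  by rewrite -leqNgt [RHS]ltn_neqAle andbC.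
rewrite (eq_bigr _ (fun j _ => E j)) big_split /=.
rewrite (exchange_big_dep xpredT) //= -big_split big1 //= => k _.
by rewrite -big_split big1 //= => j _; rewrite gN addNr.
Qed.

Lemma koszul_diffK (R : comNzRingType) n (x : 'I_n -> R) c :
  koszul_diff x (koszul_diff x c) = 0.
Proof.
apply/ffunP => T; rewrite !ffunE.
pose s (j : 'I_n) : R := (-1) ^+ #|[set k in T | (k < j)%N]|.
pose g (j k : 'I_n) : R := if [|| j \in T, k \in T | j == k] then 0 else
  s j * s k * (-1) ^+ (j < k)%N * x j * x k * c (k |: (j |: T)).
have sE (j k : 'I_n) : j \notin T ->
    (-1) ^+ #|[set l in j |: T | (l < k)%N]| = s k * (-1) ^+ (j < k)%N.
  move=> jT; rewrite -exprD; congr (_ ^+ _); case: ltnP => jk.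
    have -> : [set l in j |: T | (l < k)%N] = j |: [set l in T | (l < k)%N].
      by apply/setP => l; rewrite !inE; case: eqP => // ->.
    by rewrite cardsU1 !inE (negPf jT) /= addnC.
  rewrite addn0; apply: eq_card => l; rewrite !inE.
  by case: eqP => // -> /=; rewrite (negPf jT) ltnNge jk.
transitivity (\sum_j \sum_k g j k).
  rewrite big_mkcond; apply: eq_bigr => j _; rewrite /g.
  case: ifPn => [jT|/negPn jT]; last by rewrite big1 // => k _; rewrite jT.
  rewrite ffunE mulr_sumr big_mkcond; apply: eq_bigr => k _.
  rewrite !inE (negPf jT) negb_or [k == j]eq_sym.
  case: (j == k); case: (k \in T) => //=.
  by rewrite sE // /s; ring.
apply: sum_alt => [j|j k]; first by rewrite /g eqxx !orbT.
rewrite /g [k == j]eq_sym orbCA.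
case: ifPn => [|]; first by rewrite oppr0.
rewrite !negb_or => /and3P[_ _ jk].
rewrite (setUCA [set j]).
have -> : ((-1) ^+ (k < j)%N : R) = - (-1) ^+ (j < k)%N.
  by case: ltngtP jk => [||/val_inj->]; rewrite ?eqxx //= ?opprK.
by ring.
Qed.

(* Main.v *)
Require Import Defs.
From HB Require Import structures.
From mathcomp Require Import all_boot all_order all_algebra.
From mathcomp Require Import boolp.
From mathcomp Require classical_sets.

Set Implicit Arguments.
Unset Strict Implicit.
Unset Printing Implicit Defensive.

Import GRing.Theory.
Local Open Scope ring_scope.

(** Since H_0 = R/I and H_n = (0 : I), the hypothesis on the annihilators puts
    every Ann(H_i) between I and Ann(Ann(I)).  Everything thus amounts to
    Ann(Ann(I)) being contained in I (double_annihilator_sub).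

    This is the depth 0 case of the Auslander-Bridger formula: over an artinian
    local ring, a module of finite G-dimension has G-dimension 0.  The part of
    it that is used says that such a module M is reflexive and that
    Ext^i(M^*, R) = 0 for all i > 0 (dual_acyclic_reflexive).  Working along a
    resolution by modules of G-dimension 0, it suffices to pass from K and G to
    M in an exact sequence 0 -> K -> G -> M -> 0
    (dual_acyclic_reflexive_cokernel).  Two facts make this work.

    - The restriction G^* -> K^* is surjective (dual_map_surj).  Otherwise its
      cokernel is a nonzero module, and over an artinian local ring a nonzero
      module has a nonzero linear form (separating_functional).  This gives a
      nonzero element of K^** = K that every linear form on G kills, against
      the injectivity of G -> G^**.
    - Hence 0 -> M^* -> G^* -> K^* -> 0 is exact.  The vanishing of
      Ext^i(M^*, R) follows from that of Ext^i(G^*, R) and Ext^(i+1)(K^*, R),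
      and Ext^1(K^*, R) = 0 makes the bidual sequence exact, so that M
      inherits reflexivity from K and G.

    For the ideal I, surjectivity of R^* -> I^* means that every linear form on
    I is the multiplication by some t in R, and t is unique modulo Ann(I).  If r
    kills Ann(I), then t |-> r t is a well defined linear form on I^*, so by
    reflexivity it is the evaluation at some y in I.  On the inclusion of I in
    R, where t = 1, this reads r = y.

    No Ext module is computed: the vanishing of Ext^(i+1)(V, N) is replaced by
    a predicate on V defined by dimension shifting (Ext_acyclic), for which the
    needed parts of the long exact sequences reduce to diagram chases. *)

(** * Linear maps and short exact sequences *)

Section Linear.
Context (R : comNzRingType).

Definition lin_of (U V : lmodType R) (f : U -> V) (f_lin : linear f) :
  {linear U -> V} := HB.pack f (GRing.isLinear.Build R U V _ f f_lin).

Definition inclusion (V : lmodType R) (S : submodClosed V) :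
  {linear submod S -> V} := (val : submod S -> V).

Lemma inclusionP (V : lmodType R) (S : submodClosed V) v :
  v \in S <-> exists u, inclusion S u = v.
Proof.
split=> [vS|[u <-]]; last exact: (valP u).
by exists (Submod vS).
Qed.

Definition short_exact (A B C : lmodType R) (f : {linear A -> B})
    (g : {linear B -> C}) :=
  [/\ injective f, forall b, g b = 0 <-> exists a, f a = b &
      forall c, exists b, g b = c].

Definition ker_pred (A B : lmodType R) (g : {linear A -> B}) : {pred A} :=
  [pred a | g a == 0].

Lemma ker_pred_submod_closed (A B : lmodType R) (g : {linear A -> B}) :
  submod_closed (ker_pred g).
Proof.
split=> [|a u v]; rewrite !inE ?linear0 // linearP => /eqP-> /eqP->.
by rewrite scaler0 addr0.
Qed.
HB.instance Definition _ (A B : lmodType R) (g : {linear A -> B}) :=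
  GRing.isSubmodClosed.Build R A (ker_pred g)
    (GRing.submod_closed_semi (ker_pred_submod_closed g)).

Lemma linear_injP (A B : lmodType R) (f : {linear A -> B}) :
  (forall a, f a = 0 -> a = 0) -> injective f.
Proof.
by move=> f0 a b fab; apply/subr0_eq/f0; rewrite linearB /= fab subrr.
Qed.

Lemma short_exact_comp (A B C : lmodType R) (f : {linear A -> B})
  (g : {linear B -> C}) a : short_exact f g -> g (f a) = 0.
Proof. by move=> [_ fg _]; apply/fg; exists a. Qed.

Lemma short_exact_ker (B C : lmodType R) (g : {linear B -> C}) :
  (forall c, exists b, g b = c) ->
  exists (A : lmodType R) (f : {linear A -> B}), short_exact f g.
Proof.
move=> gS; exists (submod (ker_pred g)), (inclusion (ker_pred g)).
split=> // [u v /val_inj//|b]; rewrite -inclusionP inE.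
by split=> [->|/eqP].
Qed.

(** The form in which quotients are used: t descends to X / ker s = B, without
    any quotient being formed. *)
Lemma factor_surj (X B N : lmodType R) (s : {linear X -> B})
    (t : {linear X -> N}) :
  (forall b, exists x, s x = b) -> (forall x, s x = 0 -> t x = 0) ->
  exists u : {linear B -> N}, forall x, u (s x) = t x.
Proof.
move=> /choice[r rK] st.
have E x y : s x = s y -> t x = t y.
  by move=> sxy; apply/subr0_eq; rewrite -linearB st // linearB /= sxy subrr.
have u_lin : linear (t \o r).
  by move=> a b c; rewrite /= -linearP; apply: E; rewrite linearP /= !rK.
by exists (lin_of u_lin) => x; apply: E; rewrite rK.
Qed.

Lemma factor_inj (X A B : lmodType R) (f : {linear A -> B})
    (t : {linear X -> B}) :
  injective f -> (forall x, exists a, f a = t x) ->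
  exists u : {linear X -> A}, forall x, f (u x) = t x.
Proof.
move=> fI /choice[u uK].
have u_lin : linear u.
  by move=> a b c; apply: fI; rewrite linearP /= !uK linearP.
by exists (lin_of u_lin).
Qed.

Lemma copair_is_linear (A B C : lmodType R) (f : {linear A -> C})
  (g : {linear B -> C}) : linear (fun z : A * B => f z.1 + g z.2).
Proof. by move=> a u v; rewrite [in LHS]/= !linearP scalerDr addrACA. Qed.

Definition copair (A B C : lmodType R) (f : {linear A -> C})
    (g : {linear B -> C}) : {linear (A * B)%type -> C} :=
  lin_of (copair_is_linear f g).

Definition is_pullback (A B C X : lmodType R) (f : {linear A -> C})
    (g : {linear B -> C}) (p : {linear X -> A}) (q : {linear X -> B}) :=
  [/\ forall x, f (p x) = g (q x), forall x, p x = 0 -> q x = 0 -> x = 0 &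
      forall a b, f a = g b -> exists x, p x = a /\ q x = b].

Lemma is_pullback_sym (A B C X : lmodType R) (f : {linear A -> C})
    (g : {linear B -> C}) (p : {linear X -> A}) (q : {linear X -> B}) :
  is_pullback f g p q -> is_pullback g f q p.
Proof.
move=> [fg pq0 ex]; split=> [x|x q0 p0|b a /esym/ex[x [px qx]]].
- by rewrite fg.
- exact: pq0.
- by exists x.
Qed.

Lemma pullback_exists (A B C : lmodType R) (f : {linear A -> C})
    (g : {linear B -> C}) :
  exists (X : lmodType R) (p : {linear X -> A}) (q : {linear X -> B}),
    is_pullback f g p q.
Proof.
pose h : {linear (A * B)%type -> C} := copair f (\- g).
pose k : {linear submod (ker_pred h) -> (A * B)%type} := inclusion (ker_pred h).
have kP a b : f a = g b <-> exists x, k x = (a, b).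
  rewrite -inclusionP inE /= subr_eq0.
  by split=> /eqP.
exists (submod (ker_pred h)), (fst \o k), (snd \o k); split=> [x|x|a b].
- by apply/kP; exists x; exact: surjective_pairing.
- rewrite /= => p0 q0; apply: val_inj; rewrite -[RHS]/(k 0) linear0.
  by rewrite -[LHS]/(k x) [k x]surjective_pairing p0 q0.
- move=> /kP[x xE]; exists x; split; [exact: (congr1 fst xE)|].
  exact: (congr1 snd xE).
Qed.

Lemma pullback_factor (W A B C X : lmodType R) (f : {linear A -> C})
    (g : {linear B -> C}) (p : {linear X -> A}) (q : {linear X -> B})
    (u : {linear W -> A}) (v : {linear W -> B}) :
  is_pullback f g p q -> (forall w, f (u w) = g (v w)) ->
  exists t : {linear W -> X}, forall w, p (t w) = u w /\ q (t w) = v w.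
Proof.
move=> [_ pq0 ex] fg.
have /choice[t tE] w : exists x, p x = u w /\ q x = v w by apply: ex.
have t_lin : linear t.
  move=> a x y; apply/subr0_eq; have [[px qx] [py qy]] := (tE x, tE y).
  have [pz qz] := tE (a *: x + y); apply: pq0.
    by rewrite linearB /= pz (linearP p) (linearP u) px py subrr.
  by rewrite linearB /= qz (linearP q) (linearP v) qx qy subrr.
by exists (lin_of t_lin).
Qed.

(** The kernel of a surjection does not change under base change. *)
Lemma pullback_short_exact (A B C P X : lmodType R) (f : {linear A -> B})
    (g : {linear B -> C}) (h : {linear P -> C}) (p : {linear X -> B})
    (q : {linear X -> P}) :
  short_exact f g -> is_pullback g h p q ->
  exists i : {linear A -> X}, short_exact i q /\ forall a, p (i a) = f a.
Proof.
move=> [fI fg gS] pq; have [gh pq0 ex] := pq.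
have [a|i iE] := pullback_factor (u := f) (v := \0) pq.
  by rewrite /= linear0; apply/fg; exists a.
exists i; split=> [|a]; last by have [] := iE a.
split=> [a b iab|x|c].
- by apply: fI; rewrite -(iE a).1 iab (iE b).1.
- split=> [qx|[a <-]]; last by rewrite (iE a).2.
  have [|a aE] := (fg (p x)).1; first by rewrite gh qx linear0.
  exists a; apply/subr0_eq/pq0; rewrite linearB /=.
    by rewrite (iE a).1 aE subrr.
  by rewrite (iE a).2 qx subrr.
- by have [b bE] := gS (h c); have [x [_ xE]] := ex _ _ bE; exists x.
Qed.

Lemma pairing_is_linear (X A B : lmodType R) (f : {linear X -> A})
  (g : {linear X -> B}) : linear (fun x => (f x, g x)).
Proof. by move=> a u v; rewrite (linearP f) (linearP g). Qed.

Definition pairing (X A B : lmodType R) (f : {linear X -> A})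
    (g : {linear X -> B}) : {linear X -> (A * B)%type} :=
  lin_of (pairing_is_linear f g).

(** The retraction sends b to the preimage under f of b - s (g b), so it kills
    the image of the section s: B is the direct sum of A and P. *)
Lemma short_exact_split (A B P : lmodType R) (f : {linear A -> B})
    (g : {linear B -> P}) :
  short_exact f g -> projective P ->
  exists (s : {linear P -> B}) (r : {linear B -> A}),
    [/\ forall p, g (s p) = p, forall a, r (f a) = a, forall p, r (s p) = 0 &
        forall b, f (r b) = b - s (g b)].
Proof.
move=> [fI fg gS] /(_ B P g idfun gS)[s /= sK].
have t_lin : linear (fun b => b - s (g b)).
  by move=> a u v; rewrite (linearP g) (linearP s) scalerBr opprD addrACA.
have [|r rE] := @factor_inj B A B f (lin_of t_lin) fI.
  by move=> b; apply/fg; rewrite /= linearB /= sK subrr.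
exists s, r; split=> // [a|p]; apply: fI; rewrite rE /=.
  have -> : g (f a) = 0 by apply/fg; exists a.
  by rewrite linear0 subr0.
by rewrite sK subrr linear0.
Qed.

Lemma projective_prod (P Q : lmodType R) :
  projective P -> projective Q -> projective (P * Q)%type.
Proof.
move=> Pp Qp A B g f gS.
have l1 : linear (fun p : P => f (p, 0)).
  move=> a u v; rewrite -linearP; congr (f _).
  by apply: injective_projections => //=; rewrite scaler0 addr0.
have l2 : linear (fun q : Q => f (0, q)).
  move=> a u v; rewrite -linearP; congr (f _).
  by apply: injective_projections => //=; rewrite scaler0 addr0.
have [h hE] := Pp A B g (lin_of l1) gS.
have [k kE] := Qp A B g (lin_of l2) gS.
exists (copair h k) => -[p q]; rewrite /= linearD hE kE /= -linearD.
by congr (f _); apply: injective_projections; rewrite /= ?addr0 ?add0r.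
Qed.

Lemma projective_trivial (P : lmodType R) : trivial_mod P -> projective P.
Proof.
move=> P0 A B g f _; exists (\0 : {linear P -> A}) => p.
by rewrite (P0 p) !linear0.
Qed.

(** This is Ext^(i+1)(V, N) = 0.  In degree 1, it is tested on all extensions
    of V, so that it can be applied to an arbitrary short exact sequence.  In
    higher degrees, one projective presentation is enough, so that it can be
    read off a given resolution: Ext^(i+2)(V, N) = Ext^(i+1)(A, N) when A is
    the kernel of a surjection from a projective module to V. *)
Fixpoint Ext_acyclic (N : lmodType R) (i : nat) (V : lmodType R) : Prop :=
  match i with
  | 0%N => forall (A B : lmodType R) (f : {linear A -> B})
      (g : {linear B -> V}), short_exact f g ->
      forall phi : {linear A -> N}, exists psi : {linear B -> N},
        forall a, psi (f a) = phi a
  | j.+1 => exists (A P : lmodType R) (f : {linear A -> P})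
      (g : {linear P -> V}),
      [/\ projective P, short_exact f g & Ext_acyclic N j A]
  end.

Section Acyclic.
Context (N : lmodType R).

(** Any extension B of V by A' is the pushout of P and A' under A: a map on B
    amounts to maps on A' and on P that agree on A.  Extending phi from A' to B
    thus reduces to extending its restriction from A to P. *)
Lemma Ext_acyclic0_presentation (A P V : lmodType R) (f : {linear A -> P})
    (g : {linear P -> V}) :
  short_exact f g -> projective P ->
  (forall phi : {linear A -> N}, exists psi : {linear P -> N},
     forall a, psi (f a) = phi a) ->
  Ext_acyclic N 0 V.
Proof.
move=> [fI fg gS] Pp ext A' B f' g' [f'I fg' g'S] phi.
have [l lE] := Pp B V g' g g'S.
have [|l' l'E] := @factor_inj A A' B f' (l \o f) f'I.
  by move=> a; apply/fg'; rewrite /= lE; apply/fg; exists a.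
have [psi psiE] := ext (phi \o l').
have [||u uE] := @factor_surj _ B N (copair f' l) (copair phi psi).
- move=> b; have [p pE] := gS (g' b).
  have [|a aE] := (fg' (b - l p)).1; first by rewrite linearB /= lE pE subrr.
  by exists (a, p); rewrite /= aE subrK.
- move=> [a p] /= E.
  have /fg[w wE] : g p = 0.
    have := congr1 g' E; rewrite linear0 linearD /= lE.
    by rewrite (fg' (f' a)).2 ?add0r //; exists a.
  rewrite -wE psiE /= -linearD (f'I (a + l' w) 0) ?linear0 //.
  by rewrite linearD /= l'E /= wE.
exists u => a.
by have := uE (a, 0); rewrite /= !linear0 !addr0.
Qed.

(** Exactness of Ext(Z, N) -> Ext(Y, N) -> Ext(X, N).  In degree 1, a map is
    extended along A -> B in two steps, through the preimage of X in B.  In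
    higher degrees, the horseshoe lemma presents Y by P + Q in such a way that
    the kernels of the three presentations form a short exact sequence. *)
Lemma Ext_acyclic_ext i (X Y Z : lmodType R) (f : {linear X -> Y})
    (g : {linear Y -> Z}) :
  short_exact f g -> Ext_acyclic N i X -> Ext_acyclic N i Z ->
  Ext_acyclic N i Y.
Proof.
elim: i X Y Z f g => [|i IH] X Y Z f g [fI fg gS] /=.
  move=> Xa Za A B a b [aI ab bS] phi.
  have gbS z : exists y, (g \o b) y = z.
    by have [y <-] := gS z; have [x <-] := bS y; exists x.
  have [B' [j jgb]] := short_exact_ker gbS; have [jI jE _] := jgb.
  have [|c cE] := @factor_inj A B' B j a jI.
    move=> x; apply/jE; rewrite /= (ab (a x)).2 ?linear0 //; by exists x.
  have [|d dE] := @factor_inj B' X Y f (b \o j) fI.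
    by move=> x; apply/fg; apply/(jE (j x)); exists x.
  have [|phi' phi'E] := Xa A B' c d _ phi.
    split=> [x y cxy|x|x].
    - by apply: aI; rewrite -!cE cxy.
    - split=> [dx|[w <-]].
        have [|w wE] := (ab (j x)).1; first by rewrite -[LHS]dE dx linear0.
        by exists w; apply: jI; rewrite cE.
      by apply: fI; rewrite dE /= cE linear0; apply/ab; exists w.
    - have [w wE] := bS (f x).
      have [|v vE] := (jE w).1; first by rewrite /= wE; apply/fg; exists x.
      by exists v; apply: fI; rewrite dE /= vE.
  have [psi psiE] := Za B' B j _ jgb phi'.
  by exists psi => x; rewrite -cE psiE phi'E.
move=> [A [P [p [q [Pp [pI pq qS] Aa]]]]] [C [Q [r [s [Qp [rI rs sS] Ca]]]]].
have [l lE] := Qp Y Z g s gS.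
have hS y : exists z, copair (f \o q) l z = y.
  have [v vE] := sS (g y).
  have [|x xE] := (fg (y - l v)).1; first by rewrite linearB /= lE vE subrr.
  by have [u uE] := qS x; exists (u, v); rewrite /= uE xE subrK.
have [K [k kh]] := short_exact_ker hS; have [kI kE _] := kh.
exists K, (P * Q)%type, k, (copair (f \o q) l); split=> //.
  exact: projective_prod.
have [|c cE] := @factor_inj A K _ k (pairing p \0) kI.
  move=> a; apply/kE; rewrite /= linear0 addr0 (pq (p a)).2 ?linear0 //.
  by exists a.
have [|d dE] := @factor_inj K C Q r (snd \o k) rI.
  move=> x; apply/rs => /=; have /kE : exists y, k y = k x by exists x.
  move=> /(congr1 g); rewrite linear0 linearD /= lE.
  by rewrite (fg (f _)).2 ?add0r //; exists (q (k x).1).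
apply: (IH A K C c d) => //; split=> [x y cxy|x|w].
- by apply: pI; have := congr1 k cxy; rewrite !cE /= => -[].
- split=> [dx|[w <-]].
    have kx2 : (k x).2 = 0 by have /= <- := dE x; rewrite dx linear0.
    have /kE : exists y, k y = k x by exists x.
    rewrite /= kx2 linear0 addr0 => fq0.
    have [|w wE] := (pq (k x).1).1; first by apply: fI; rewrite fq0 linear0.
    exists w; apply: kI; rewrite cE /= wE -kx2; by case: (k x).
  by apply: rI; rewrite dE /= cE linear0.
- have /fg[x xE] : g (- l (r w)) = 0.
    by rewrite linearN /= lE (rs (r w)).2 ?oppr0 //; exists w.
  have [u uE] := qS x.
  have [|y yE] := (kE (u, r w)).1; first by rewrite /= uE xE addNr.
  by exists y; apply: rI; rewrite dE /= yE.
Qed.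

Lemma Ext_acyclic_projective i (P : lmodType R) :
  projective P -> Ext_acyclic N i P.
Proof.
elim: i P => [|i IH] P Pp /=.
  move=> A B f g fg phi; have [s [r [_ rK _ _]]] := short_exact_split fg Pp.
  by exists (phi \o r) => a; rewrite /= rK.
have [K [k kP]] : exists (A : lmodType R) (f : {linear A -> P}),
    short_exact f idfun.
  by apply: short_exact_ker => p; exists p.
exists K, P, k, idfun; split=> //; apply: IH; apply: projective_trivial => x.
by have [kI kE _] := kP; apply: kI; rewrite linear0; apply/kE; exists x.
Qed.

(** X is isomorphic to the direct sum of C and P, so this says that acyclicity
    passes to direct summands. *)
Lemma Ext_acyclic_ker_projective i (C X P : lmodType R) (f : {linear C -> X})
    (g : {linear X -> P}) :
  short_exact f g -> projective P -> Ext_acyclic N i X -> Ext_acyclic N i C.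
Proof.
move=> fgP Pp; have [s [r [sK rK rs rE]]] := short_exact_split fgP Pp.
have [fI fg gS] := fgP.
case: i => [|i] /=.
  move=> Xa A B a b abP phi.
  (* Base change along the retraction turns an extension of C into an extension
     of X that contains B. *)
  have [Y [u [v uv]]] := pullback_exists b r.
  have [j [jv uj]] := pullback_short_exact abP uv.
  have [y|d dE] := pullback_factor (u := idfun) (v := f \o b) uv.
    by rewrite /= rK.
  have [psi psiE] := Xa A Y j v jv phi.
  exists (psi \o d) => y; rewrite /= -psiE; congr (psi _).
  have [_ uv0 _] := uv; apply/subr0_eq/uv0; rewrite linearB /=.
    by rewrite (dE (a y)).1 uj subrr.
  rewrite (dE (a y)).2 /= (short_exact_comp y abP) linear0.
  by rewrite (short_exact_comp y jv) subrr.
move=> [A [Q [p [q [Qp [pI pq qS] Aa]]]]].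
have hS c : exists x, (r \o q) x = c.
  by have [x xE] := qS (f c); exists x; rewrite /= xE rK.
(* The kernel of Q -> X -> C is an extension of P by the kernel of Q -> X. *)
have [K [k kP]] := short_exact_ker hS; have [kI kE _] := kP.
exists K, Q, k, (r \o q); split=> //.
have [|c cE] := @factor_inj A K Q k p kI.
  move=> y; apply/kE; rewrite /= (pq (p y)).2 ?linear0 //; by exists y.
apply: (@Ext_acyclic_ext i A K P c (g \o q \o k)) => //; last first.
  exact: Ext_acyclic_projective.
split=> [x y cxy|u|z].
- by apply: pI; rewrite -!cE cxy.
- split=> [/= gqk0|[y <-]]; last first.
    by rewrite /= cE (pq (p y)).2 ?linear0 //; exists y.
  have rqk0 : r (q (k u)) = 0 by apply/(kE (k u)); exists u.
  have [|y yE] := (pq (k u)).1.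
    by have := rE (q (k u)); rewrite rqk0 gqk0 (linear0 f) (linear0 s) subr0.
  by exists y; apply: kI; rewrite cE.
- have [x xE] := qS (s z); have [|u uE] := (kE x).1; first by rewrite /= xE rs.
  by exists u; rewrite /= uE xE sK.
Qed.

(** Exactness of Ext^(i+1)(B, N) -> Ext^(i+1)(C, N) -> Ext^(i+2)(A, N).  For a
    projective presentation 0 -> O -> P -> A -> 0, the pullback X of B and P
    over A is an extension of B by O, and also of the projective module P by
    C. *)
Lemma Ext_acyclic_ker i (C B A : lmodType R) (f : {linear C -> B})
    (g : {linear B -> A}) :
  short_exact f g -> Ext_acyclic N i B -> Ext_acyclic N i.+1 A ->
  Ext_acyclic N i C.
Proof.
move=> fg Ba [O [P [p [q [Pp pq Oa]]]]].
have [X [u [v uv]]] := pullback_exists g q.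
have [j [jv _]] := pullback_short_exact fg uv.
have [k [ku _]] := pullback_short_exact pq (is_pullback_sym uv).
apply: (Ext_acyclic_ker_projective jv Pp).
exact: (Ext_acyclic_ext ku).
Qed.

End Acyclic.

(** * Resolutions *)

Lemma subquot_pi_eq0 (V : lmodType R) (Z B : submodClosed V) (u : submod Z) :
  (@quotmod_pi R (submod Z) (restr_pred (Z := Z) B) u : subquot Z B) = 0 <->
  submod_val u \in B.
Proof.
rewrite -(linear0 (@quotmod_pi R (submod Z) (restr_pred (Z := Z) B))).
by rewrite (rwP eqP) quotmod_piE subr0 inE.
Qed.

Section Tail.
Context (M : lmodType R) (G : resolution M).
Context (K : lmodType R) (f : {linear K -> G 0%N}) (p : {linear G 1%N -> K}).
Context (fP : short_exact f (res_aug G)).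
Context (fp : forall u, f (p u) = res_diff G 0%N u).

Lemma tail_surj k : exists u, p u = k.
Proof.
have [fI _ _] := fP; have /res_exact0[u uE] := short_exact_comp k fP.
by exists u; apply: fI; rewrite fp.
Qed.

Lemma tail_exact0 u : p u = 0 <-> exists v, res_diff G 1%N v = u.
Proof.
have [fI _ _] := fP; rewrite -res_exactS -fp.
by split=> [->|fpu]; [rewrite linear0 | apply: fI; rewrite fpu linear0].
Qed.

(** What remains of G without G_0 resolves the first syzygy of M. *)
Definition resolution_tail : resolution K :=
  @Resolution R K (fun i => G i.+1) (fun i => res_diff G i.+1) p
    tail_surj tail_exact0 (fun i => @res_exactS R M G i.+1).
End Tail.

Lemma resolution_tail_exists (M : lmodType R) (G : resolution M) :
  exists (K : lmodType R) (f : {linear K -> G 0%N}) (p : {linear G 1%N -> K}),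
    short_exact f (res_aug G) /\ forall u, f (p u) = res_diff G 0%N u.
Proof.
have [K [f fP]] := short_exact_ker (@res_aug_surj R M G).
have [fI fg _] := fP; have [|p pE] := factor_inj (t := res_diff G 0%N) fI.
  by move=> u; apply/fg/res_exact0; exists u.
by exists K, f, p.
Qed.

(** Dimension shifting: the cohomology of Hom(P, N) in degree i + 2 is that of
    the tail of P, which resolves the first syzygy, in degree i + 1. *)
Lemma Ext_acyclic_of_cocycles (N M : lmodType R) (P : resolution M) i :
  (forall j, projective (P j)) ->
  (forall phi : {linear P i.+1 -> N},
     (forall u, phi (res_diff P i.+1 u) = 0) ->
     exists psi : {linear P i -> N}, forall u, phi u = psi (res_diff P i u)) ->
  Ext_acyclic N i M.
Proof.
elim: i M P => [|i IH] M P Pp ext; have [K [f [p [fP fp]]]] :=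
  resolution_tail_exists P.
  apply: (Ext_acyclic0_presentation fP) => // phi.
  have [u|psi psiE] := ext (phi \o p).
    rewrite /= (_ : p _ = 0) ?linear0 //; have [fI _ _] := fP.
    by apply: fI; rewrite fp linear0; apply/res_exactS; exists u.
  exists psi => k; have [u <-] := tail_surj fP fp k.
  by rewrite fp -psiE.
exists K, (P 0%N), f, (res_aug P); split=> //.
apply: (IH K (resolution_tail fP fp)) => [j|]; first exact: Pp.
exact: ext.
Qed.

Lemma Ext_vanishes_acyclic (N M : lmodType R) i :
  Ext_vanishes M N i.+1 -> Ext_acyclic N i M.
Proof.
move=> [P [Pp ext0]]; apply: (Ext_acyclic_of_cocycles Pp) => phi phi0.
have phiZ : (phi : Defs.Hom (P i.+1) N) \in @ext_cocycle R M P N i.+1.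
  by apply/asboolP => u; apply: phi0.
have /subquot_pi_eq0 := ext0 (quotmod_pi _ (Submod phiZ)).
by rewrite inE => /asboolP[psi psiE]; exists psi.
Qed.

End Linear.

(** * Linear forms over artinian local rings *)

Section Local.
Context (R : comNzRingType).

(** Submodules as propositions on elements, because Zorn's lemma produces a set
    rather than a boolean predicate. *)
Definition is_submodule (V : lmodType R) (S : V -> Prop) :=
  S 0 /\ forall a u v, S u -> S v -> S (a *: u + v).

Lemma is_submoduleZ (V : lmodType R) (S : V -> Prop) a u :
  is_submodule S -> S u -> S (a *: u).
Proof. by move=> [S0 SP] Su; rewrite -[_ *: _]addr0; apply: SP. Qed.

Lemma is_submoduleD (V : lmodType R) (S : V -> Prop) u v :
  is_submodule S -> S u -> S v -> S (u + v).
Proof. by move=> [_ SP] Su Sv; rewrite -[u]scale1r; apply: SP. Qed.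

Lemma is_submoduleB (V : lmodType R) (S : V -> Prop) u v :
  is_submodule S -> S u -> S v -> S (u - v).
Proof.
move=> SM Su Sv; rewrite -scaleN1r; apply: is_submoduleD => //.
exact: is_submoduleZ.
Qed.

Lemma submodClosed_of (V : lmodType R) (S : V -> Prop) :
  is_submodule S -> exists J : submodClosed V, forall v, v \in J <-> S v.
Proof.
move=> [S0 SP]; pose T : {pred V} := fun v => `[< S v >].
have TC : submod_closed T.
  by split=> [|a u v]; rewrite /in_mem /= !asboolE //; apply: SP.
exists (HB.pack_for (submodClosed V) T
  (GRing.isSubmodClosed.Build R V T (GRing.submod_closed_semi TC))).
by move=> v; rewrite /in_mem /= asboolE.
Qed.

(** By maximality, v0 belongs to the submodule spanned by S and any v outside S.
    This serves twice: it yields the maximal ideals of R (with v0 = 1), and the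
    hyperplanes of a vector space over the residue field. *)
Lemma maximal_avoiding_submodule (V : lmodType R) (N : V -> Prop) (v0 : V) :
  is_submodule N -> ~ N v0 ->
  exists S : V -> Prop, [/\ is_submodule S, forall v, N v -> S v, ~ S v0 &
    forall v, ~ S v -> exists r y, S y /\ v0 = r *: v + y].
Proof.
move=> NM Nv0.
(* Zorn's lemma is applied to the sets A such that the union of N and A is a
   suitable submodule, so that the union of the empty chain is admissible. *)
pose P (A : classical_sets.set V) :=
  is_submodule (fun v => N v \/ A v) /\ ~ A v0.
have [|A [[AM Av0] Amax]] := @classical_sets.Zorn_bigcup V P.
  move=> F FP Ftot; split; last by move=> [A FA Av0]; have [_ []] := FP A FA.
  split=> [|a u v]; first by left; case: NM.
  have join A u' v' : F A -> N u' \/ A u' -> N v' \/ A v' ->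
      N (a *: u' + v') \/ classical_sets.bigcup F id (a *: u' + v').
    move=> FA Au Av; have [[_ AP] _] := FP A FA.
    by have [Nw|Aw] := AP a _ _ Au Av; [left | right; exists A].
  move=> [Nu|[A FA Au]] [Nv|[B FB Bv]].
  - by left; case: NM => _; apply.
  - by apply: (join B) => //; [left | right].
  - by apply: (join A) => //; [right | left].
  - have [AB|BA] := Ftot A B FA FB.
      by apply: (join B) => //; right=> //; apply: AB.
    by apply: (join A) => //; right=> //; apply: BA.
exists (fun v => N v \/ A v); split=> // [v Nv|[]//|v vS]; first by left.
have [//|noex] := pselect (exists r y, (N y \/ A y) /\ v0 = r *: v + y).
pose B w := exists r y, (N y \/ A y) /\ w = r *: v + y.
have AB w : N w \/ A w -> B w by exists 0, w; rewrite scale0r add0r.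
have NB w : N w \/ B w <-> B w by split=> [[Nw|//]|]; [apply: AB; left | right].
case: (Amax B).
  split=> [w Aw|BA]; first by apply: AB; right.
  apply: vS; right; apply: BA; exists 1, 0; rewrite scale1r addr0.
  by split=> //; case: AM.
split=> //; split=> [|a u w]; first by left; case: NM.
move=> /NB[r [y [Sy ->]]] /NB[s [z [Sz ->]]]; apply/NB.
exists (a * r + s), (a *: y + z); split; first by case: AM => _; apply.
by rewrite scalerDl scalerDr scalerA addrACA.
Qed.

(** This singles out the maximal ideal of a local ring by an elementwise
    condition instead of a comparison with the other ideals. *)
Definition local_at (m : ideal R) :=
  (1 : R^o) \notin m /\ forall r : R^o, r \notin m -> exists c : R, c * r = 1.

(** A non-unit r lies in a maximal ideal, which can only be m. *)
Lemma local_ring_local_at : local_ring R -> exists m : ideal R, local_at m.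
Proof.
move=> [m [[m1 _] muniq]]; exists m; split=> // r rm.
have [//|rU] := pselect (exists c : R, c * r = 1).
pose N (y : R^o) := exists c : R, c * r = y.
have NM : is_submodule N.
  split=> [|a _ _ [c <-] [d <-]]; first by exists 0; rewrite mul0r.
  by exists (a * c + d); rewrite mulrDl -mulrA.
have [S [SM NS S1 Smax]] := maximal_avoiding_submodule NM rU.
have [J JS] := submodClosed_of SM.
have J1 : (1 : R^o) \notin J by apply/negP => /JS.
have /muniq mJ : maximal_ideal J.
  split=> // J' JJ' J'1 v; apply/idP/idP => [vJ'|/JJ'//].
  have [/JS//|vS] := pselect (S v); have [s [y [Sy E]]] := Smax v vS.
  by case/negP: J'1; rewrite E rpredD ?rpredZ //; apply/JJ'/JS.
by case/negP: rm; rewrite -mJ; apply/JS/NS; exists 1; rewrite mul1r.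
Qed.

Context (m : ideal R) (m_local : local_at m) (R_artinian : artinian R).

Lemma local_subr1 (b c : R) : (b : R^o) \in m -> exists d, d * (1 - c * b) = 1.
Proof.
have [m1 mU] := m_local => bm; apply: mU; apply: contra m1 => mb.
by rewrite -[1](subrK (c * b)) rpredD //; apply: (rpredZ c bm).
Qed.

(** The image a (V / N) is nonzero and killed by m.  If there were no such a,
    then any a that does not map V into N could be replaced by b a for some b in
    m.  The resulting descending chain of principal ideals is stationary, so
    that a = c b a for some a of the chain and some b in m; as 1 - c b is a
    unit, a = 0. *)
Lemma last_multiplier (V : lmodType R) (N : V -> Prop) (w : V) :
  is_submodule N -> ~ N w ->
  exists a : R, (exists v, ~ N (a *: v)) /\
    forall (b : R) v, (b : R^o) \in m -> N (b *: (a *: v)).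
Proof.
move=> NM Nw; apply: contrapT => noa.
have /choice[b bP] (a : R) : exists b : R, (b : R^o) \in m /\
    ((exists v, ~ N (a *: v)) -> exists v, ~ N ((b * a) *: v)).
  have [av|nav] := pselect (exists v, ~ N (a *: v)); last first.
    by exists 0; split=> //; apply: rpred0.
  apply: contrapT => nob; apply: noa; exists a; split=> // b v bm.
  apply: contrapT => Nbav; apply: nob; exists b; split=> // _.
  by exists v; rewrite -scalerA.
pose a k := iter k (fun a => b a * a) 1.
have aN k : exists v, ~ N (a k *: v).
  elim: k => [|k IH]; first by exists w; rewrite scale1r.
  by case: (bP (a k)) => _; apply.
have /choice[J JP] k : exists J : ideal R,
    forall y, y \in J <-> exists c : R, c * a k = y.
  apply: submodClosed_of; split=> [|e _ _ [c <-] [d <-]].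
    by exists 0; rewrite mul0r.
  by exists (e * c + d); rewrite mulrDl -mulrA.
have [|k0 stab] := R_artinian (J := J).
  move=> k y /JP[c <-]; apply/JP; exists (c * b (a k)).
  exact: esym (mulrA _ _ _).
have /JP[c cE] : a k0 \in J k0.+1.
  by rewrite stab //; apply/JP; exists 1; rewrite mul1r.
have [bm _] := bP (a k0); have [d dE] := local_subr1 c bm.
have a0 : a k0 = 0.
  rewrite -[a k0]mul1r -dE -mulrA mulrBl mul1r -[c * _ * _]mulrA.
  by rewrite [c * _]cE subrr mulr0.
have [v] := aN k0; rewrite a0 scale0r; by case: NM.
Qed.

(** Multiplication by a suitable a maps V onto a nonzero submodule of V / N
    killed by m, that is, onto a vector space over the residue field.  A
    hyperplane of that vector space gives a surjection from V to the residue
    field, which embeds in R as the multiples of a nonzero element s that m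
    kills. *)
Lemma separating_functional (V : lmodType R) (N : V -> Prop) (w : V) :
  is_submodule N -> ~ N w ->
  exists h : {linear V -> R^o}, (forall v, N v -> h v = 0) /\
    exists v, h v <> 0.
Proof.
move=> NM Nw.
(* s spans a copy of the residue field R / m in R. *)
have [s [s0 ms]] : exists s : R, s <> 0 /\
    forall b : R, (b : R^o) \in m -> b * s = 0.
  have [||s [[v sv] ms]] := @last_multiplier R^o (eq^~ 0) 1.
  - by split=> // a u v -> ->; rewrite scaler0 addr0.
  - by apply/eqP; apply: oner_neq0.
  exists s; split=> [s0|b bm]; first by apply: sv; rewrite s0 scale0r.
  by have := ms b 1 bm; rewrite /GRing.scale /= mulr1.
have [a [[v0 av0] ma]] := last_multiplier NM Nw.
have aM : is_submodule (fun v => N (a *: v)).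
  split=> [|c u v Nu Nv]; first by rewrite scaler0; case: NM.
  rewrite scalerDr scalerA mulrC -scalerA.
  by case: NM => _; apply.
(* S contains m V, and V / S is the line spanned by v0 over the residue field;
   r v is a coordinate of v on v0, well defined modulo m. *)
have [S [SM NS Sv0 Smax]] := maximal_avoiding_submodule aM av0.
have mS (b : R) v : (b : R^o) \in m -> S (b *: v).
  by move=> bm; apply: NS; rewrite scalerA mulrC -scalerA; apply: ma.
have mE (b : R) : S (b *: v0) -> (b : R^o) \in m.
  move=> Sb; apply/negPn/negP => /(proj2 m_local)[c cb]; apply: Sv0.
  by rewrite -[v0]scale1r -cb -scalerA; apply: is_submoduleZ.
have /choice[r rP] v : exists r : R, S (v - r *: v0).
  have [Sv|/Smax[c [y [Sy E]]]] := pselect (S v).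
    by exists 0; rewrite scale0r subr0.
  have [cm|/(proj2 m_local)[d dc]] := boolP ((c : R^o) \in m).
    by case: Sv0; rewrite E; apply: is_submoduleD => //; apply: mS.
  exists d; rewrite E scalerDr scalerA dc scale1r opprD addrA subrr add0r.
  by rewrite -scaleNr; apply: is_submoduleZ.
have rE (c : R) v : S (v - c *: v0) -> r v * s = c * s.
  move=> Sc; apply/subr0_eq; rewrite -mulrBl; apply: ms; apply: mE.
  rewrite (_ : _ *: v0 = (v - c *: v0) - (v - r v *: v0)).
    exact: is_submoduleB.
  by rewrite scalerBl opprB [RHS]addrC addrA subrK.
have h_lin : linear (fun v => r v * s : R^o).
  move=> c u v; rewrite (rE (c * r u + r v)).
    by rewrite mulrDl -mulrA.
  rewrite scalerDl opprD addrACA -scalerA -scalerBr.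
  by apply: is_submoduleD => //; apply: is_submoduleZ.
exists (lin_of h_lin); split=> [v Nv|].
  rewrite /= (rE 0) ?mul0r // scale0r subr0; apply: NS.
  exact: is_submoduleZ.
exists v0; rewrite /= (rE 1) ?mul1r // scale1r subrr.
by case: SM.
Qed.

End Local.

(** * Reflexive modules with an acyclic dual *)

Section Dual.
Context (R : comNzRingType).

Definition dual_map_fun (A B : lmodType R) (f : {linear A -> B})
  (psi : dual B) : dual A := (psi : Defs.Hom B R^o) \o f : {linear A -> R^o}.

Lemma dual_map_is_linear (A B : lmodType R) (f : {linear A -> B}) :
  linear (dual_map_fun f).
Proof. by move=> a u v; apply: Hom_ext. Qed.

Definition dual_map (A B : lmodType R) (f : {linear A -> B}) :
  {linear dual B -> dual A} := lin_of (dual_map_is_linear f).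

(** The half of total reflexivity that passes from K and G to M in a short exact
    sequence 0 -> K -> G -> M -> 0 over an artinian local ring. *)
Definition dual_acyclic_reflexive (M : lmodType R) :=
  bijective (@biduality R M) /\ forall i, Ext_acyclic R^o i (dual M).

Lemma totally_reflexive_dual_acyclic (M : lmodType R) :
  totally_reflexive M -> dual_acyclic_reflexive M.
Proof.
by move=> [_ bij _ ext]; split=> // i; apply/Ext_vanishes_acyclic/ext.
Qed.

Lemma inj_surj_bijective (A B : Type) (f : A -> B) :
  injective f -> (forall b, exists a, f a = b) -> bijective f.
Proof. by move=> fI /choice[g gK]; exists g => // a; apply: fI; rewrite gK. Qed.

Lemma dual_acyclic_reflexive_trivial (M : lmodType R) :
  trivial_mod M -> dual_acyclic_reflexive M.
Proof.
move=> M0; have dM0 : trivial_mod (dual M).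
  by move=> phi; apply: Hom_ext => u; rewrite (M0 u) !linear0.
split=> [|i]; last by apply: Ext_acyclic_projective; apply: projective_trivial.
apply: inj_surj_bijective => [u v _|h]; first by rewrite (M0 u) (M0 v).
by exists 0; apply: Hom_ext => phi; rewrite (dM0 phi) !linear0.
Qed.

Context (m : ideal R) (m_local : local_at m) (R_artinian : artinian R).

(** A linear form h on A^* that kills the image of B^* is the evaluation at some
    a in A; every linear form on B kills f a, so f a = 0, then a = 0 and h = 0.
    Hence the image of B^* cannot be a proper submodule. *)
Lemma dual_map_surj (A B : lmodType R) (f : {linear A -> B}) :
  injective f -> injective (@biduality R B) -> bijective (@biduality R A) ->
  forall phi : dual A, exists psi : dual B, dual_map f psi = phi.
Proof.
move=> fI bI [ev _ evK] phi; apply: contrapT => nphi.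
have imM : is_submodule (fun phi => exists psi, dual_map f psi = phi).
  split=> [|a _ _ [u <-] [v <-]]; first by exists 0; rewrite linear0.
  by exists (a *: u + v); rewrite linearP.
have [h [h0 [phi' hphi']]] := separating_functional m_local R_artinian imM nphi.
pose a := ev (h : dual (dual A)).
have hE psi : h psi = (psi : Defs.Hom A R^o) a.
  by rewrite -[LHS]/((h : dual (dual A)) psi) -[h in LHS]evK.
apply: hphi'; rewrite hE.
suff -> : a = 0 by rewrite linear0.
apply: fI; apply: bI; apply: Hom_ext => psi; rewrite linear0.
rewrite /biduality /= /dual_eval.
rewrite (linear0 (psi : Defs.Hom B R^o)).
have := h0 (dual_map f psi) (ex_intro _ psi erefl).
by rewrite hE.
Qed.

Lemma dual_short_exact (K G M : lmodType R) (f : {linear K -> G})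
    (g : {linear G -> M}) :
  short_exact f g ->
  (forall phi : dual K, exists psi : dual G, dual_map f psi = phi) ->
  short_exact (dual_map g) (dual_map f).
Proof.
move=> fgP fS; have [_ fg gS] := fgP; split=> // [u v uv|psi].
  apply: Hom_ext => y; have [b <-] := gS y.
  by have := congr1 (fun h : Defs.Hom G R^o => h b) uv.
split=> [psi0|[mu <-]].
  have [|mu muE] := factor_surj (s := g) (t := (psi : Defs.Hom G R^o)) gS.
    move=> b /fg[k <-].
    by have := congr1 (fun h : Defs.Hom K R^o => h k) psi0.
  by exists mu; apply: Hom_ext.
apply: Hom_ext => k; rewrite /= /dual_map_fun /=.
by rewrite (short_exact_comp k fgP) linear0.
Qed.

(** The rows of the biduality diagram are exact: the dual sequence is exact, and
    Ext^1(K^*, R) = 0 extends to G^* every linear form on the submodule M^*.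
    The conclusion on biduality is then that of the five lemma. *)
Lemma dual_acyclic_reflexive_cokernel (K G M : lmodType R)
    (f : {linear K -> G}) (g : {linear G -> M}) :
  short_exact f g -> dual_acyclic_reflexive K -> dual_acyclic_reflexive G ->
  dual_acyclic_reflexive M.
Proof.
move=> fgP [Kbij Ka] [Gbij Ga]; have [fI fg gS] := fgP.
have fS := dual_map_surj fI (bij_inj Gbij) Kbij.
have dP := dual_short_exact fgP fS.
split=> [|i]; last exact: (Ext_acyclic_ker dP).
have [evK _ evKK] := Kbij; have [evG _ evGK] := Gbij.
apply: inj_surj_bijective => [|H].
  apply: linear_injP => y y0; have [b bE] := gS y.
  have [||u uE] := factor_surj (s := dual_map f)
      (t := (biduality b : Defs.Hom (dual G) R^o)).
  - exact: fS.
  - move=> psi; have [_ dE _] := dP; move=> /dE[mu <-].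
    have := congr1 (fun h : Defs.Hom (dual M) R^o => h mu) y0.
    by rewrite /biduality /= /dual_eval /= /dual_map_fun /= bE.
  (* A lift b of an element of the kernel of M -> M^** is, as a form on G^*, the
     pullback of a form u on K^*, hence it comes from an element k of K. *)
  pose k := evK (u : dual (dual K)).
  suff fk : f k = b by rewrite -bE -fk; apply: short_exact_comp fgP.
  apply: (bij_inj Gbij); apply: Hom_ext => psi; rewrite -uE.
  by rewrite -[u in RHS](evKK u).
have [H' H'E] := Ka 0%N _ _ _ _ dP (H : Defs.Hom (dual M) R^o).
exists (g (evG (H' : dual (dual G)))); apply: Hom_ext => mu.
rewrite -H'E.
exact: (congr1 (fun h : Defs.Hom (dual G) R^o => h (dual_map g mu)) (evGK H')).
Qed.

(** Here k counts the terms of the resolution, so that the induction starts with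
    M = 0. *)
Lemma resolution_dual_acyclic_reflexive k (M : lmodType R) (G : resolution M) :
  (forall i, dual_acyclic_reflexive (G i)) ->
  (forall i, (k <= i)%N -> trivial_mod (G i)) ->
  dual_acyclic_reflexive M.
Proof.
elim: k M G => [|k IH] M G Gr G0.
  apply: dual_acyclic_reflexive_trivial => x.
  by have [u <-] := res_aug_surj G x; rewrite (G0 0%N isT u) linear0.
have [K [f [p [fP fp]]]] := resolution_tail_exists G.
apply: (dual_acyclic_reflexive_cokernel fP) => //.
apply: (IH K (resolution_tail fP fp)) => i; first exact: Gr.
exact: (G0 i.+1).
Qed.

Lemma finite_Gdim_dual_acyclic_reflexive (M : lmodType R) :
  finite_Gdim M -> dual_acyclic_reflexive M.
Proof.
move=> [k [G [Gr G0]]].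
apply: (@resolution_dual_acyclic_reflexive k.+1 M G) => // i.
exact: totally_reflexive_dual_acyclic.
Qed.

Lemma regular_biduality_inj : injective (@biduality R R^o).
Proof.
apply: linear_injP => a /(congr1 (fun h : Defs.Hom (dual R^o) R^o =>
  h (idfun : {linear R^o -> R^o}))).
by rewrite /biduality /= /dual_eval.
Qed.

Lemma regular_linearE (f : {linear R^o -> R^o}) (a : R) : f a = a * f 1.
Proof. by rewrite -{1}[a]mulr1 -[a * 1]/(a *: (1 : R^o)) linearZ. Qed.

(** The form psi |-> r psi(1) on R^* kills the forms that vanish on I, hence it
    descends to I^*, where it is the evaluation at some y in I. *)
Lemma double_annihilator_sub (I : ideal R) (r : R) :
  finite_Gdim (submod I) ->
  (forall t : R, (forall a : R^o, a \in I -> t * a = 0) -> r * t = 0) ->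
  (r : R^o) \in I.
Proof.
move=> /finite_Gdim_dual_acyclic_reflexive[Ibij _] rI.
have incI : injective (inclusion I) by move=> u v /val_inj.
have fS := dual_map_surj incI regular_biduality_inj Ibij.
have [|h hE] := factor_surj (s := dual_map (inclusion I))
  (t := r \*: (biduality (1 : R^o) : Defs.Hom (dual R^o) R^o)) fS.
  move=> psi psi0; rewrite /= /dual_eval; apply: rI => a aI.
  rewrite mulrC -regular_linearE.
  exact: (congr1 (fun k : Defs.Hom (submod I) R^o => k (Submod aI)) psi0).
have [ev _ evK] := Ibij; pose y := ev (h : dual (dual (submod I))).
suff -> : (r : R^o) = inclusion I y by apply/inclusionP; exists y.
have := hE (idfun : {linear R^o -> R^o}).
rewrite -[h in LHS](evK h) /= /dual_eval /=.
by rewrite /GRing.scale /= mulr1.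
Qed.

End Dual.

(** * Koszul homology in the extreme degrees *)

Section Koszul.
Context (R : comNzRingType).

Lemma annihilator_subquotP (V : lmodType R) (Z B : submodClosed V) (r : R) :
  (r : R^o) \in annihilator (subquot Z B) <->
  forall v, v \in Z -> r *: v \in B.
Proof.
split=> [|rB].
  rewrite inE => /asboolP r0 v vZ.
  have := r0 (quotmod_pi _ (Submod vZ)).
  by rewrite -linearZ => /subquot_pi_eq0.
rewrite inE; apply/asboolP => u; rewrite -[u]quotmod_reprK -linearZ.
apply/subquot_pi_eq0.
by rewrite -[submod_val _]/(inclusion Z _) linearZ; apply: rB; apply: valP.
Qed.

Context (n : nat) (x : 'I_n -> R) (I : ideal R) (I_gen : generated_by x I).

Lemma annihilator_koszul0 r :
  r \in I -> r \in annihilator (koszul_homology x 0).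
Proof.
move=> /I_gen[a ->]; apply/annihilator_subquotP => c /andP[/koszul_degP c0 _].
(* If r = sum of the a_j x_j, then r c is the boundary of the sum of the
   a_j c e_j. *)
pose b : koszul R n := [ffun S : {set 'I_n} =>
  \sum_j (if S == [set j] then a j * c set0 else 0)].
rewrite inE; apply/asboolP; exists b.
  apply/koszul_degP => S S1; rewrite ffunE big1 // => j _.
  by case: eqP => // SE; rewrite SE cards1 in S1.
apply/ffunP => T; rewrite !ffunE.
have [->|T0] := eqVneq T set0; last first.
  rewrite c0 ?cards_eq0 // scaler0 big1 // => j jT.
  rewrite ffunE big1 ?mulr0 //.
  move=> k _; case: eqP => // /setP E; case/set0Pn: T0 => l lT.
  move: (E j) (E l); rewrite !inE eqxx lT orbT /= => /esym/eqP jk /esym/eqP lk.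
  by rewrite jk -lk lT in jT.
rewrite /GRing.scale /= mulr_suml [RHS](eq_bigl xpredT); last first.
  by move=> j; rewrite inE.
apply: eq_bigr => j _; rewrite ffunE.
rewrite (_ : #|_| = 0%N) ?expr0 ?mul1r; last first.
  by apply: eq_card0 => k; rewrite !inE.
rewrite (bigD1 j) //= setU0 eqxx big1 ?addr0; first by rewrite mulrCA mulrA.
by move=> k kj; rewrite (inj_eq set1_inj) eq_sym (negPf kj).
Qed.

(** As there are no forms of degree n + 1, H_n is the module of the forms
    t e_1 /\ ... /\ e_n with t in Ann(I). *)
Lemma annihilator_koszul_top r (t : R) :
  r \in annihilator (koszul_homology x n) ->
  (forall a : R^o, a \in I -> t * a = 0) -> r * t = 0.
Proof.
move=> /annihilator_subquotP r0 tI.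
pose c : koszul R n := [ffun S : {set 'I_n} => if S == setT then t else 0].
have cZ : c \in koszul_cycle x n.
  apply/andP; split.
    apply/koszul_degP => S Sn; rewrite ffunE; case: eqP => // SE.
    by rewrite SE cardsT card_ord eqxx in Sn.
  apply/eqP/ffunP => T; rewrite !ffunE big1 // => j _; rewrite ffunE.
  case: eqP => _; last by rewrite mulr0.
  rewrite -mulrA [x j * t]mulrC tI ?mulr0 //; apply/I_gen.
  exists (fun i => (i == j)%:R).
  rewrite (bigD1 j) //= eqxx mul1r big1 ?addr0 //.
  by move=> i /negPf->; rewrite mul0r.
have := r0 c cZ; rewrite inE => /asboolP[b /koszul_degP bS E].
have b0 : b = 0.
  apply/ffunP => S; rewrite ffunE bS // neq_ltn ltnS.
  by rewrite (leq_trans (max_card _)) ?card_ord.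
move: E; rewrite b0 linear0 => /ffunP/(_ setT).
by rewrite !ffunE eqxx.
Qed.

End Koszul.

Theorem corollary8p2 (R : comNzRingType) (n : nat) (x : 'I_n -> R)
    (I : ideal R)
    (R_artinian : artinian R) (R_local : local_ring R)
    (I_gen : generated_by x I) (I_Gdim : finite_Gdim (submod I))
    (ann_sub : forall i : nat, (i < n)%N ->
       {subset annihilator (koszul_homology x i)
          <= annihilator (koszul_homology x i.+1)}) :
  forall i : nat, (1 <= i <= n)%N -> annihilator (koszul_homology x i) =i I.
Proof.
have ann_mono i j : (i <= j <= n)%N ->
    {subset annihilator (koszul_homology x i)
       <= annihilator (koszul_homology x j)}.
  elim: j => [|j IH]; first by rewrite leqn0 => /andP[/eqP-> _].
  move=> /andP[]; rewrite leq_eqVlt ltnS => /predU1P[-> _ r //|ij jn r ri].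
  by apply: ann_sub => //; apply: IH => //; rewrite ij ltnW.
move=> i /andP[_ i_n] r; apply/idP/idP => [ri|rI]; last first.
  apply: (ann_mono 0%N); first by rewrite leq0n.
  exact: annihilator_koszul0 I_gen _ rI.
have [m m_local] := local_ring_local_at R_local.
apply: (double_annihilator_sub m_local R_artinian I_Gdim) => t tI.
apply: (annihilator_koszul_top I_gen _ tI); apply: ann_mono ri.
by rewrite i_n leqnn.
Qed.
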